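(* Let $\varphi\in SE$ be continuous, let $B\subseteq(0,\infty)$ be measurable and non-null, let $f:\mathbb{R}_+\to\mathbb{R}_+$ be Lebesgue measurable, let $\{a_q\}_{q\in\mathbb{Q}_+}$ be a positive family, and let $g:B\to\mathbb{R}_+$ be non-trivial. If the Kendall condition $$a_q f(q\circ_\varphi t)\to g(t)\qquad (t\in B,\ q\to\infty,\ q\in\mathbb{Q}),\quad\text{locally uniformly in }t,$$ holds, then $f$ is $\varphi$-regularly varying, with $$f(x+t\varphi(x))/f(x)\to K(t)\qquad(x\to\infty),\quad\text{for }t>0,$$ where $K$ is continuous and satisfies the equation $$K(u\circ_\eta v)=K(v)K(u)\qquad(u,v>0),$$ with $\eta$ the limit function associated with $\varphi$.
   Context: $\mathbb{R}_+:=(0,\infty)$; $\mathbb{Q}_+$ is the set of positive rationals. For a function $h$, the Popa operation is $s\circ_h t:=s+t\,h(s)$. In particular $x\circ_\varphi t=x+t\varphi(x)$ and $u\circ_\eta v=u+v\eta(u)$. A function $\varphi:\mathbb{R}_+\to\mathbb{R}_+$ is self-equivarying, $\varphi\in SE$, if $\varphi(x)=O(x)$ as $x\to\infty$ and $\eta_x(t):=\varphi(x+t\varphi(x))/\varphi(x)\to\eta(t)$ as $x\to\infty$, locally uniformly in $t>0$, for some limit function $\eta$ (the limit function associated with $\varphi$). When $\varphi$ is measurable, this is of the form $\eta(t)=1+\rho t$ for some $\rho\ge0$. For $\varphi\in SE$, a function $f:\mathbb{R}_+\to\mathbb{R}_+$ is $\varphi$-regularly varying if for some function $K$, $f(x+t\varphi(x))/f(x)\to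 K(t)$ as $x\to\infty$, locally uniformly in $t>0$. A function $g:B\to\mathbb{R}_+$ is trivial if it takes values only in $\{0,1\}$; non-trivial otherwise.
   Formalization: ''Locally uniformly in t'' in the Kendall condition is taken as: for each t in B, a_q f(q∘_φ s) → g(t) jointly as q → ∞ and s → t, with s in a full neighbourhood of t, not only in B; with uniformity over B only, the claim is false. *)

(* Defs.v *)
From HB Require Import structures.
From mathcomp Require Import all_boot all_order all_algebra.
From mathcomp Require Import all_classical all_reals all_analysis.
Import Order.TTheory GRing.Theory Num.Theory.
Import numFieldNormedType.Exports.
Set Implicit Arguments.
Unset Strict Implicit.
Unset Printing Implicit Defensive.
Local Open Scope classical_set_scope.
Local Open Scope ring_scope.

(* A function R_+ -> R_+ (with R_+ = (0, +oo)) is represented by a total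
   function R -> R that is positive on (0, +oo); nothing below depends on its
   values elsewhere. *)
Definition positive_fun (R : realType) (f : R -> R) : Prop :=
  forall x, 0 < x -> 0 < f x.

Definition popa (R : realType) (h : R -> R) (s t : R) : R := s + t * h s.

(* Locally uniform convergence on the open half-line (0, +oo), that is, uniform
   convergence on its compact subsets. *)
Definition loc_unif_cvg (R : realType) (h : R -> R -> R) (k : R -> R) : Prop :=
  {family compactly_in (`]0, +oo[ : set R), h @ +oo --> k}.

Definition se_limit (R : realType) (phi eta : R -> R) : Prop :=
  loc_unif_cvg (fun x t => phi (popa phi x t) / phi x) eta.

(* Needed for the notation f =O_+oo g. *)
Canonical pinfty_filter_on (R : realType) : filter_on R :=
  FilterType (pinfty_nbhs R) _.

Definition self_equivarying (R : realType) (phi : R -> R) : Prop :=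
  [/\ positive_fun phi, phi =O_+oo (fun x : R => x)
    & exists eta, se_limit phi eta].

Definition regularly_varying (R : realType) (phi f : R -> R) : Prop :=
  positive_fun f /\
  exists K, loc_unif_cvg (fun x t => f (popa phi x t) / f x) K.

Definition trivial_on (R : realType) (B : set R) (g : R -> R) : Prop :=
  forall t, B t -> g t = 0 \/ g t = 1.

(* The real line with the sigma-algebra of Lebesgue measurable sets; the
   instance on R itself is the Borel one. *)
Definition lebesgue_type (R : realType) :=
  caratheodory_type ((wlength (idfun : R -> R))^*)%mu.
HB.instance Definition _ (R : realType) := Measurable.on (lebesgue_type R).

Definition lebesgue_measurable (R : realType) (B : set R) : Prop :=
  measurable (B : set (lebesgue_type R)).

Definition lebesgue_measurable_fun (R : realType) (f : R -> R) : Prop :=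
  measurable_fun (`]0, +oo[ : set (lebesgue_type R)) (f : lebesgue_type R -> R).

(* a_q f(q o_phi t) -> g(t), locally uniformly at each t in B: the error is
   small for all rational q large enough and all s in some neighbourhood of t
   in (0, +oo), i.e., a_q f(q o_phi s) -> g(t) jointly as q -> +oo in the
   rationals and s -> t.  The neighbourhood is not intersected with B.  Were it,
   f would be uncontrolled at the points x that are of the form q o_phi s with q
   rational for no s in B: for phi = 1, B = (1, 2) minus the rationals,
   a_q = e^-q and g(t) = e^t, the value of f at rational points would be
   arbitrary.  When B is open, this is locally uniform convergence on B to a
   limit g that is continuous on B. *)
Definition kendall_condition (R : realType) (phi f : R -> R) (B : set R)
    (a : rat -> R) (g : R -> R) : Prop :=
  forall t, B t ->
    a p.1 * f (popa phi (ratr p.1) p.2)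
      @[p --> filter_prod +oo_rat (nbhs t)] --> g t.

(* Main.v *)
(* Put h = ln f. Since phi is continuous, a rational q can be replaced by any real y
   close to it at the cost of a negligible change of s in q o_phi s, so the Kendall
   condition extends to real y. Every large x is y o_phi t with y large; for t, t' in
   B, comparing the conditions at t and t' along y shows that h(x o_phi v) - h(x) has
   a limit as x -> oo and v -> (t' - t) / eta(t) jointly. Let G be the set of the u for
   which such a joint limit k(u) exists. Then u o_eta v is in G, with
   k(u o_eta v) = k(u) + k(v), whenever u > 0 and v are in G; and G is closed, because
   k(0) = 0 is the case t = t'. Moreover eta >= 1: otherwise some orbit
   x -> x o_phi t would converge to a positive zero of phi. If G had no positive
   element below some c > 0, distinct points of B would be at distance at least c and
   B would be countable, hence null. So G has arbitrarily small positive elements,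
   and being closed and stable under o_eta it contains (0, oo). Then K = exp k; joint
   convergence gives both continuity and locally uniform convergence. *)
Require Import Defs.
From HB Require Import structures.
From mathcomp Require Import all_boot all_order all_algebra.
From mathcomp Require Import all_classical all_reals all_analysis.
From mathcomp Require Import ring lra.
Import Order.TTheory GRing.Theory Num.Theory.
Import numFieldNormedType.Exports.
Local Open Scope classical_set_scope.
Local Open Scope ring_scope.

Lemma cvg_filter_prod {T U V : Type} {F : set_system T} {FF : Filter F}
    {G : set_system U} {H : set_system V} {f : T -> U} {g : T -> V} :
  f @ F --> G -> g @ F --> H ->
  (f x, g x) @[x --> F] --> filter_prod G H.
Proof.
move=> fG gH W [[A B] /= [GA HB] AB].
have fA : \forall x \near F, A (f x) by exact: fG.
have gB : \forall x \near F, B (g x) by exact: gH.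
suff : \forall x \near F, W (f x, g x) by [].
by near=> x; apply: AB; split => /=; near: x.
Unshelve. all: by end_near.
Qed.

Section regular_variation.
Set Implicit Arguments.
Unset Strict Implicit.
Unset Printing Implicit Defensive.
Context {R : realType}.
Implicit Types (phi eta f h b : R -> R) (B : set R).

(** * Joint limits of increments along the Popa operation *)

(** The limit is taken jointly, so it still applies when the shift varies with the base point and
    only tends to [u]. At [u = 0] shifts of both signs are covered. *)
Definition shift_limit phi h (u k : R) : Prop :=
  h (popa phi p.1 p.2) - h p.1 @[p --> filter_prod +oo_R (nbhs u)] --> k.

Lemma shift_limit_pointwise phi h u k : shift_limit phi h u k ->
  h (popa phi x u) - h x @[x --> +oo] --> k.
Proof.
move=> huk.
have xu : (x, u) @[x --> +oo_R] --> filter_prod +oo_R (nbhs u).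
  by apply: cvg_filter_prod; [exact: cvg_id|exact: cvg_cst].
exact: (cvg_comp _ _ xu huk).
Qed.

Lemma cvg_popa_pinfty phi u : positive_fun phi -> 0 <= u ->
  popa phi x u @[x --> +oo] --> +oo.
Proof.
move=> phi_pos u0; apply: ger_cvgy; last exact: cvg_id.
near=> x; have /phi_pos/ltW phix : 0 < x by near: x; exact: nbhs_pinfty_gt.
by rewrite /popa lerDl mulr_ge0.
Unshelve. all: by end_near. Qed.

(** With [y = popa phi x u], the point [popa phi x s] equals [popa phi y w] for
    [w = (s - u) * phi x / phi y], and [w] tends to [v] as [s] tends to [u + v * e]. The joint limit
    at [v] is therefore read off along [y], which tends to infinity with [x]. *)
Lemma shift_limit_at phi h (u v e l : R) : positive_fun phi -> 0 < u -> 0 < e ->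
  phi (popa phi x u) / phi x @[x --> +oo] --> e ->
  shift_limit phi h v l ->
  h (popa phi p.1 p.2) - h (popa phi p.1 u)
    @[p --> filter_prod +oo_R (nbhs (u + v * e))] --> l.
Proof.
move=> phi_pos u0 e0 ue hvl.
set F := filter_prod _ _.
have F1 : p.1 @[p --> F] --> +oo by exact: cvg_fst.
have F2 : p.2 @[p --> F] --> u + v * e by exact: cvg_snd.
pose w (p : R * R) := (p.2 - u) * (phi (popa phi p.1 u) / phi p.1)^-1.
have Fw : w @ F --> v.
  have -> : v = (u + v * e - u) * e^-1 by rewrite addrAC subrr add0r mulfK ?gt_eqF.
  apply: cvgM; first by apply: cvgB => //; exact: cvg_cst.
  by apply: cvgV; [rewrite gt_eqF|exact: (cvg_comp _ _ F1 ue)].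
have Fuw : (popa phi p.1 u, w p) @[p --> F] --> filter_prod +oo_R (nbhs v).
  apply: cvg_filter_prod => //.
  exact: (cvg_comp _ _ F1 (cvg_popa_pinfty phi_pos (ltW u0))).
apply: cvg_trans (cvg_comp _ _ Fuw hvl).
apply: near_eq_cvg; near=> p.
have p0 : 0 < p.1 by near: p; exact: cvgry_gt F1 _.
congr (h _ - _); rewrite /w /= {1}/popa invf_div mulrA divfK; last first.
  by rewrite gt_eqF// phi_pos// /popa addr_gt0// mulr_gt0// phi_pos.
by rewrite /popa -addrA -mulrDl addrCA subrr addr0.
Unshelve. all: by end_near. Qed.

(** The increment is split at [popa phi x u]. The first piece has the fixed shift [u]; the second
    carries all the variation of the shift. *)
Lemma shift_limitD phi h (u v e k l : R) : positive_fun phi -> 0 < u -> 0 < e ->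
  phi (popa phi x u) / phi x @[x --> +oo] --> e ->
  shift_limit phi h u k -> shift_limit phi h v l ->
  shift_limit phi h (u + v * e) (k + l).
Proof.
move=> phi_pos u0 e0 ue huk hvl; rewrite /shift_limit.
have := shift_limit_at phi_pos u0 e0 ue hvl.
set F := filter_prod _ _ => hl.
have F1 : p.1 @[p --> F] --> +oo by exact: cvg_fst.
have hk := cvg_comp _ _ F1 (shift_limit_pointwise huk).
rewrite addrC; apply: cvg_trans (cvgD hl hk).
by apply: near_eq_cvg; near=> p; rewrite /= addrA subrK.
Unshelve. all: by end_near. Qed.

(** The joint limit at [0], transported to [u], makes [h (popa phi x s) - h (popa phi x u)] small
    for [x] large and [s] near [u]. The limit at a nearby [v] thus eventually approximates the
    increment at [u], which gives the Cauchy criterion. *)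
Lemma shift_limit_closed phi h (u e : R) : positive_fun phi -> 0 < u -> 0 < e ->
  phi (popa phi x u) / phi x @[x --> +oo] --> e ->
  shift_limit phi h 0 0 ->
  (forall d, 0 < d -> exists v k, `|v - u| < d /\ shift_limit phi h v k) ->
  exists k, shift_limit phi h u k.
Proof.
move=> phi_pos u0 e0 ue h00 uG.
have := shift_limit_at phi_pos u0 e0 ue h00.
rewrite mul0r addr0; set F := filter_prod _ _ => hu.
have F1 : p.1 @[p --> F] --> +oo by exact: cvg_fst.
(* A limit along the fixed shift [u] is enough: adding [hu] makes it joint. *)
suff /cvg_ex[k hk] : cvg (h (popa phi x u) - h x @[x --> +oo]).
  exists k; rewrite /shift_limit -[k]add0r.
  apply: cvg_trans (cvgD hu (cvg_comp _ _ F1 hk)).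
  by apply: near_eq_cvg; near=> p; rewrite /= addrA subrK.
apply/cauchy_cvgP/cauchy_exP => eps eps0.
have e20 : 0 < eps / 2 by rewrite divr_gt0.
have /cvgrPdist_lt/(_ _ e20) [[A U] /= [Aoo Uu] AU] := hu.
have /nbhs_ballP[d /= d0 dU] := Uu.
have [v [k [vud hvk]]] := uG _ d0.
have /cvgrPdist_lt/(_ _ e20) hk := shift_limit_pointwise hvk.
exists k; near=> x; rewrite /ball /=.
have -> : k - (h (popa phi x u) - h x) = (k - (h (popa phi x v) - h x))
    - (0 - (h (popa phi x v) - h (popa phi x u))) by ring.
rewrite [ltRHS]splitr (le_lt_trans (ler_normB _ _))// ltrD//; first by near: x.
apply: (AU (x, v)); split => /=; first by near: x.
by apply: dU; rewrite /ball /= distrC.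
Unshelve. all: by end_near. Qed.

(** * Orbits and range of the map [x -> popa phi x t] *)

(** If [eta t < 1], then far out each step of the orbit multiplies [phi] by less than a fixed
    [l < 1], so the increasing orbit is bounded. By continuity its limit [L] satisfies
    [t * phi L = 0], against positivity. *)
Lemma se_limit_ge1 phi eta (t : R) : positive_fun phi ->
  {in `]0, +oo[, continuous phi} -> 0 < t ->
  phi (popa phi x t) / phi x @[x --> +oo] --> eta t -> 1 <= eta t.
Proof.
move=> phi_pos phi_cont t0 phit; rewrite leNgt; apply/negP => eta1.
pose l := (eta t + 1) / 2.
have etal : eta t < l by rewrite /l; lra.
have l1 : l < 1 by rewrite /l; lra.
have [X [X0 contr]] : exists X, 0 < X /\
    forall x, X <= x -> phi (popa phi x t) < l * phi x.
  have [M [_ phiM]] := cvgr_lt _ phit _ etal.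
  exists (Num.max M 0 + 1); split.
    by rewrite ltr_wpDl// le_max lexx orbT.
  move=> x; rewrite -lerBrDr => Mx.
  have /ltr_pM2r <- : 0 < (phi x)^-1.
    by rewrite invr_gt0 phi_pos//; move: Mx; rewrite ge_max => /andP[_]; lra.
  rewrite mulfK; last first.
    by rewrite gt_eqF// phi_pos//; move: Mx; rewrite ge_max => /andP[_]; lra.
  by apply: phiM; move: Mx; rewrite ge_max => /andP[]; lra.
pose x := fix x n := if n is m.+1 then popa phi (x m) t else X.
have xge n : X <= x n.
  elim: n => //= n Xn; rewrite /popa (le_trans Xn)// lerDl mulr_ge0// ltW//.
  by rewrite phi_pos// (lt_le_trans X0).
have x0 n : 0 < x n by exact: lt_le_trans (xge n).
have xS n : x n.+1 = x n + t * phi (x n) by [].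
(* Since t + c l = c, the quantity x + c phi(x) does not increase along the orbit. *)
pose c := t / (1 - l).
have c0 : 0 < c by rewrite divr_gt0// subr_gt0.
have cE : t + c * l = c by rewrite /c; field; lra.
have xub n : x n + c * phi (x n) <= X + c * phi X.
  elim: n => // n; apply: le_trans.
  have := contr _ (xge n); rewrite -(ltr_pM2l c0).
  have -> : c * phi (x n) = t * phi (x n) + c * (l * phi (x n)).
    by rewrite -{1}cE; ring.
  by rewrite xS /popa; lra.
have x_nd : nondecreasing_seq x.
  apply/nondecreasing_seqP => n.
  by rewrite xS lerDl mulr_ge0// ltW// phi_pos.
have x_ub : has_ubound (range x).
  exists (X + c * phi X) => _ [n _ <-].
  by apply: le_trans (xub n); rewrite lerDl mulr_ge0// ltW// phi_pos.
have xL := nondecreasing_cvgn x_nd x_ub; set L := sup _ in xL.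
have L0 : 0 < L.
  apply: lt_le_trans X0 _; apply: sup_ubound => //.
  by exists 0%N.
have phiL : phi (x n) @[n --> \oo] --> phi L.
  by apply: (cvg_comp _ _ xL); apply: phi_cont; rewrite in_itv/= L0.
have xLS : x n.+1 @[n --> \oo] --> L + t * phi L.
  by apply: cvgD => //; apply: cvgM => //; exact: cvg_cst.
have xLS' : x n.+1 @[n --> \oo] --> L by rewrite (cvg_shiftS x).
have /eqP : L + t * phi L = L by exact: (cvg_unique (@Rhausdorff R) xLS xLS').
by rewrite -subr_eq0 addrC addKr mulf_eq0 !gt_eqF// phi_pos.
Unshelve. all: by end_near. Qed.

(** The intermediate value theorem solves [popa phi y t = x] for large [x]. The bound
    [phi y <= C * y] gives [x <= (1 + t * C) * y], which forces the solution to infinity. *)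
Lemma popa_surj phi (t : R) : positive_fun phi ->
  {in `]0, +oo[, continuous phi} -> phi =O_+oo (fun x : R => x) -> 0 < t ->
  exists Y : R -> R, Y x @[x --> +oo] --> +oo /\
    \forall x \near +oo, popa phi (Y x) t = x.
Proof.
move=> phi_pos phi_cont /eqO_exP[C C0 [M [_ phiC]]] t0.
(* From [y0] on, arguments are positive and exceed [M], so the bound on [phi] holds there. *)
pose y0 := Num.max M 0 + 1.
have y00 : 0 < y0 by rewrite ltr_wpDl// le_max lexx orbT.
have phiy y : y0 <= y -> phi y <= C * y.
  rewrite /y0 -lerBrDr ge_max => /andP[My y1].
  have y_gt0 : 0 < y by lra.
  have := phiC y; rewrite !gtr0_norm// ?phi_pos//; apply; lra.
have solve x : popa phi y0 t <= x ->
    exists y, [/\ y0 <= y & popa phi y t = x].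
  move=> y0x.
  have y0_le_x : y0 <= x.
    by apply: le_trans y0x; rewrite lerDl mulr_ge0// ltW// phi_pos.
  have [||y] := @IVT R (popa phi ^~ t) y0 x x y0_le_x.
  - apply: continuous_subspace_itv => y; rewrite in_itv/= => /andP[y0y _].
    apply: cvgD; first exact: cvg_id.
    apply: cvgM; first exact: cvg_cst.
    by apply: phi_cont; rewrite in_itv/= (lt_le_trans y00).
  - rewrite ge_min y0x/= le_max; apply/orP; right.
    by rewrite lerDl mulr_ge0// ltW// phi_pos// (lt_le_trans y00).
  - by rewrite in_itv/= => /andP[y0y _] yx; exists y.
have /choice[Y YP] : forall x, exists y, popa phi y0 t <= x ->
    y0 <= y /\ popa phi y t = x.
  move=> x; have [/solve[y []]|] := leP (popa phi y0 t) x.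
    by exists y.
  (* Dummy value for the small [x], which the limit at infinity ignores. *)
  by exists 0.
have large : \forall x \near +oo, popa phi y0 t <= x.
  by apply: nbhs_pinfty_ge; exact: num_real.
exists Y; split; last by near=> x; apply: (YP x _).2; near: x.
have tC : 0 < 1 + t * C by rewrite addr_gt0// mulr_gt0.
apply: (ger_cvgy (f := fun x => x * (1 + t * C)^-1)); last first.
  by apply: gt0_cvgMly; [rewrite invr_gt0|exact: cvg_id].
near=> x; rewrite ler_pdivrMr//.
have [y0Y YE] : y0 <= Y x /\ popa phi (Y x) t = x.
  by apply: YP; near: x.
rewrite -[leLHS]YE mulrDr mulr1 lerD2l mulrCA ler_pM2l// mulrC.
exact: phiy.
Unshelve. all: by end_near. Qed.

(** * From rational to real base points, and from there to joint limits *)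

(** A real [y] is replaced by a rational [r y] so close that [popa phi y s = popa phi (r y) w] with
    [w] tending to [t] as [y] tends to infinity and [s] to [t]; then [b] is [a] composed with
    [r]. *)
Lemma kendall_real phi h B (a : rat -> R) (g : R -> R) :
  positive_fun phi -> {in `]0, +oo[, continuous phi} ->
  (forall t, B t ->
    a p.1 + h (popa phi (ratr p.1) p.2)
      @[p --> filter_prod +oo_rat (nbhs t)] --> g t) ->
  exists b, forall t, B t ->
    b p.1 + h (popa phi p.1 p.2)
      @[p --> filter_prod +oo_R (nbhs t)] --> g t.
Proof.
move=> phi_pos phi_cont kendall.
(* The first error sends [r y] to infinity with [y]; the other two control the change of shift. The
   rate [y^-1] serves only to make all three vanish at infinity. *)
have approx y : exists r : rat, 0 < y ->
    [/\ `|y - ratr r| < y^-1, `|(y - ratr r) / phi (ratr r)| < y^-1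
      & `|phi y / phi (ratr r) - 1| < y^-1].
  have [y0|_] := ltP 0 y; last by exists 0.
  have phiy : phi z @[z --> y] --> phi y by apply: phi_cont; rewrite in_itv/= y0.
  have yV : 0 < y^-1 by rewrite invr_gt0.
  have phiy0 : phi y != 0 by rewrite gt_eqF// phi_pos.
  have c1 : y - z @[z --> y] --> 0.
    by rewrite -[X in _ --> X](subrr y); apply: cvgB; [exact: cvg_cst|exact: cvg_id].
  have c2 : (y - z) / phi z @[z --> y] --> 0.
    by rewrite -[X in _ --> X](mul0r (phi y)^-1); apply: cvgM => //; exact: cvgV.
  have c3 : phi y / phi z - 1 @[z --> y] --> 0.
    rewrite -[X in _ --> X](subrr 1) -{2}(divff phiy0).
    apply: cvgB; last exact: cvg_cst.
    by apply: cvgM; [exact: cvg_cst|exact: cvgV].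
  move: c1 c2 c3 => /cvgr0Pnorm_lt/(_ _ yV) c1 /cvgr0Pnorm_lt/(_ _ yV) c2
    /cvgr0Pnorm_lt/(_ _ yV) c3.
  have : \forall z \near y, [/\ `|y - z| < y^-1, `|(y - z) / phi z| < y^-1
      & `|phi y / phi z - 1| < y^-1].
    by near=> z; split; near: z.
  move=> /nbhs_ballP[d /= d0 dy].
  have [r] : exists r : rat, ratr r \in `]y, y + d[.
    by apply: rat_in_itvoo; rewrite ltrDl.
  rewrite in_itv/= => /andP[yr rd]; exists r => _; apply: dy.
  by rewrite /ball/= ltr_norml; apply/andP; split; lra.
have [r rP] := choice approx.
have yV0 : (fun y : R => y^-1) @ +oo --> 0.
  by apply/gtr0_cvgV0 => //; exact: nbhs_pinfty_gt.
have rP' : \forall y \near +oo, [/\ `|y - ratr (r y)| < y^-1,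
    `|(y - ratr (r y)) / phi (ratr (r y))| < y^-1
    & `|phi y / phi (ratr (r y)) - 1| < y^-1].
  by near=> y; apply: rP; near: y; exact: nbhs_pinfty_gt.
have small (e : R -> R) : (\forall y \near +oo, `|e y| < y^-1) -> e @ +oo --> 0.
  move=> e_small; apply/cvgr0Pnorm_lt => eps eps0.
  have /cvgr0Pnorm_lt/(_ _ eps0) yV := yV0.
  near=> y; rewrite (@lt_trans _ _ y^-1)//; first by near: y.
  by rewrite (le_lt_trans (ler_norm _))//; near: y.
have r1 : y - ratr (r y) @[y --> +oo] --> 0.
  by apply: small; apply: filterS rP' => y [].
have r2 : (y - ratr (r y)) / phi (ratr (r y)) @[y --> +oo] --> 0.
  by apply: small; apply: filterS rP' => y [].
have r3 : phi y / phi (ratr (r y)) - 1 @[y --> +oo] --> 0.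
  by apply: small; apply: filterS rP' => y [].
have r_gt (M : R) : \forall y \near +oo, M < ratr (r y).
  have /cvgr0Pnorm_lt/(_ _ ltr01) r1' := r1.
  near=> y; have : `|y - ratr (r y)| < 1 by near: y.
  have : M + 1 < y by near: y; apply: nbhs_pinfty_gt; exact: num_real.
  by move=> My; rewrite ltr_norml => /andP[_]; lra.
have r4 : r @ +oo --> +oo_rat.
  move=> A [M [_ MA]]; suff : \forall y \near +oo, A (r y) by [].
  by apply: filterS (r_gt (ratr M)) => y; rewrite ltr_rat; exact: MA.
exists (a \o r) => t Bt; set F := filter_prod _ _.
have F1 : p.1 @[p --> F] --> +oo by exact: cvg_fst.
have F2 : p.2 @[p --> F] --> t by exact: cvg_snd.
(* The shift from [r y] that reaches [popa phi y s]. The ratio is written as [(ratio - 1) + 1] to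
   match the error controlled by [r3]. *)
pose w (p : R * R) := (p.1 - ratr (r p.1)) / phi (ratr (r p.1)) +
  p.2 * ((phi p.1 / phi (ratr (r p.1)) - 1) + 1).
have Fw : w @ F --> t.
  rewrite -[t]add0r -[in X in _ --> _ + X](mulr1 t) -[X in t * X]add0r.
  apply: cvgD; first exact: (cvg_comp _ _ F1 r2).
  apply: cvgM => //; apply: cvgD; last exact: cvg_cst.
  exact: (cvg_comp _ _ F1 r3).
have Frw : (r p.1, w p) @[p --> F] --> filter_prod +oo_rat (nbhs t).
  by apply: cvg_filter_prod => //; exact: (cvg_comp _ _ F1 r4).
apply: cvg_trans (cvg_comp _ _ Frw (kendall t Bt)).
apply: near_eq_cvg; near=> p => /=.
have rp0 : 0 < ratr (r p.1) :> R.
  by near: p; exact: F1 (r_gt 0).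
congr (_ + h _); rewrite /popa /w subrK.
by field; rewrite gt_eqF// phi_pos.
Unshelve. all: by end_near. Qed.

(** Write [x = popa phi y t]. Then [popa phi x v = popa phi y w] with [w = t + v * (phi x / phi y)],
    which tends to [t'] as [v] tends to [(t' - t) / e]. In the difference of the two Kendall limits
    along [y] the term [b y] cancels. *)
Lemma shift_limit_kendall phi h b (t t' e l l' : R) : positive_fun phi ->
  {in `]0, +oo[, continuous phi} -> phi =O_+oo (fun x : R => x) ->
  0 < t -> 0 < e -> phi (popa phi x t) / phi x @[x --> +oo] --> e ->
  b p.1 + h (popa phi p.1 p.2) @[p --> filter_prod +oo_R (nbhs t)] --> l ->
  b p.1 + h (popa phi p.1 p.2) @[p --> filter_prod +oo_R (nbhs t')] --> l' ->
  shift_limit phi h ((t' - t) / e) (l' - l).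
Proof.
move=> phi_pos phi_cont phiO t0 e0 te bt bt'.
have [Y [Yoo YE]] := popa_surj phi_pos phi_cont phiO t0.
set u := (t' - t) / e; rewrite /shift_limit; set F := filter_prod _ _.
have F1 : p.1 @[p --> F] --> +oo by exact: cvg_fst.
have F2 : p.2 @[p --> F] --> u by exact: cvg_snd.
pose w (p : R * R) := t + p.2 * (phi (popa phi (Y p.1) t) / phi (Y p.1)).
have FY : Y p.1 @[p --> F] --> +oo by exact: (cvg_comp _ _ F1 Yoo).
have Fw : w @ F --> t'.
  have -> : t' = t + u * e by rewrite divfK ?gt_eqF// addrC subrK.
  apply: cvgD; first exact: cvg_cst.
  by apply: cvgM => //; exact: (cvg_comp _ _ FY te).
have Ft : t @[_ --> F] --> t by exact: cvg_cst.
apply: cvg_trans (cvgB (cvg_comp _ _ (cvg_filter_prod FY Fw) bt')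
  (cvg_comp _ _ (cvg_filter_prod FY Ft) bt)).
apply: near_eq_cvg; near=> p.
have Y0 : 0 < Y p.1 by near: p; exact: cvgry_gt FY _.
have Yp : popa phi (Y p.1) t = p.1 by near: p; exact: F1 YE.
have wp : popa phi (Y p.1) (w p) = popa phi p.1 p.2.
  rewrite /w Yp {1}/popa mulrDl addrA -mulrA divfK ?gt_eqF ?phi_pos//.
  by rewrite -/(popa phi (Y p.1) t) Yp.
by rewrite !fctE /= wp Yp; ring.
Unshelve. all: by end_near. Qed.

(** * Existence of the joint limit at every positive shift *)

(** Each interval from [n * c] to [(n + 1) * c], right end excluded, holds at most one point of [B],
    so the integer [n] identifies the point; [pickle] codes it as a natural number. *)
Lemma separated_countable B (c : R) : 0 < c ->
  (forall s t, B s -> B t -> s < t -> c <= t - s) -> countable B.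
Proof.
move=> c0 Bc; apply/countable_injP.
exists (fun t => pickle (Num.floor (t / c))) => s t.
rewrite !inE => Bs Bt /(pcan_inj pickleK) st.
wlog sltt : s t Bs Bt st / s < t.
  by move=> W; have [/W->|/W->|] := ltgtP s t.
have := Bc _ _ Bs Bt sltt; rewrite -(ler_pM2r (_ : 0 < c^-1)) ?invr_gt0//.
rewrite divff ?gt_eqF// mulrBl.
have := floor_le (s / c); have := floorD1_gt (t / c); rewrite -st intrD; lra.
Qed.

Lemma shift_limit_gt0 phi eta h B b (g : R -> R) : self_equivarying phi ->
  {in `]0, +oo[, continuous phi} ->
  (forall t, 0 < t -> phi (popa phi x t) / phi x @[x --> +oo] --> eta t) ->
  B `<=` `]0, +oo[ -> ~ countable B ->
  (forall t, B t -> b p.1 + h (popa phi p.1 p.2)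
    @[p --> filter_prod +oo_R (nbhs t)] --> g t) ->
  forall u, 0 < u -> exists k, shift_limit phi h u k.
Proof.
move=> [phi_pos phiO _] phi_cont phi_eta B_pos B_unc bg.
have eta1 t : 0 < t -> 1 <= eta t.
  by move=> t0; apply: (se_limit_ge1 phi_pos phi_cont t0); exact: phi_eta.
have eta0 t : 0 < t -> 0 < eta t by move=> /eta1; exact: lt_le_trans.
have B0 t : B t -> 0 < t by move=> /B_pos /=; rewrite in_itv/= andbT.
pose G u := exists k, shift_limit phi h u k.
have GB s t : B s -> B t -> G ((t - s) / eta s).
  move=> Bs Bt; exists (g t - g s).
  by apply: (shift_limit_kendall phi_pos phi_cont phiO (B0 _ Bs)
    (eta0 _ (B0 _ Bs)) (phi_eta _ (B0 _ Bs)) (bg _ Bs) (bg _ Bt)).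
have [t0 Bt0] : exists t, B t.
  by apply/set0P; apply: contra_notN B_unc => /eqP ->; exact: countable0.
have h00 : shift_limit phi h 0 0.
  have := shift_limit_kendall phi_pos phi_cont phiO (B0 _ Bt0)
    (eta0 _ (B0 _ Bt0)) (phi_eta _ (B0 _ Bt0)) (bg _ Bt0) (bg _ Bt0).
  by rewrite !subrr mul0r.
(* Otherwise any [s < t] in [B] satisfy [c <= (t - s) / eta s <= t - s], the last bound by
   [1 <= eta s], and [B] is [c]-separated. *)
have Gsmall c : 0 < c -> exists u, [/\ 0 < u, u < c & G u].
  move=> c0; apply: contrapT => noG; apply: B_unc.
  apply: (separated_countable c0) => s t Bs Bt st.
  have ds : 0 < (t - s) / eta s by rewrite divr_gt0 ?subr_gt0// eta0// B0.
  have : c <= (t - s) / eta s.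
    rewrite leNgt; apply/negP => dc; apply: noG; exists ((t - s) / eta s).
    by split => //; exact: GB.
  move=> /le_trans; apply; rewrite ler_pdivrMr ?eta0 ?B0//.
  by rewrite ler_peMr ?eta1 ?B0// ltW// subr_gt0.
have GD u v : 0 < u -> G u -> G v -> G (u + v * eta u).
  move=> u0 [k uk] [l vl]; exists (k + l).
  exact: (shift_limitD phi_pos u0 (eta0 _ u0) (phi_eta _ u0)).
have Gclosed u : 0 < u -> (forall d, 0 < d -> exists v, `|v - u| < d /\ G v) ->
    G u.
  move=> u0 uG; apply: (shift_limit_closed phi_pos u0 (eta0 _ u0) (phi_eta _ u0) h00).
  by move=> d /uG[v [vu [k vk]]]; exists v, k.
(* The supremum [s] of [A] lies in [G] by closedness. If [s < u], adding a small element of [G] to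
   [s] gives a larger element of [A], a contradiction. *)
move=> u u0; pose A := [set v | [/\ 0 < v, v <= u & G v]].
have [a [a0 au Ga]] := Gsmall u u0.
have Aa : A a by split => //; exact: ltW.
have A_ub : ubound A u by move=> v [].
have A_sup : has_sup A by split; [exists a|exists u].
pose s := sup A.
have as_ : a <= s by apply: sup_upper_bound => //.
have s0 : 0 < s by exact: lt_le_trans as_.
have su : s <= u by apply: ge_sup => //; exists a.
have Gs : G s.
  apply: Gclosed => // d d0.
  have [v [v0 vu Gv] sv] := sup_adherent d0 A_sup.
  exists v; split => //; rewrite ltr_norml.
  have : v <= s by apply: sup_upper_bound.
  by rewrite -/s in sv *; move=> vs; apply/andP; split; lra.
move: su; rewrite le_eqVlt => /predU1P[<-//|su].
(* This threshold keeps [s + v * eta s] below [u]. *)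
have [|v [v0 vsmall Gv]] := Gsmall ((u - s) / eta s).
  by rewrite divr_gt0 ?subr_gt0 ?eta0.
have : A (s + v * eta s).
  split; [|by move: vsmall; rewrite ltr_pdivlMr ?eta0// => ?; lra|exact: GD].
  by rewrite addr_gt0// mulr_gt0// eta0.
move=> /(sup_upper_bound A_sup); rewrite -/s gerDl leNgt mulr_gt0// eta0//.
Qed.

(** * Joint convergence, continuity and local uniformity *)

Lemma loc_unif_cvg_pointwise (H : R -> R -> R) (K : R -> R) (t : R) : 0 < t ->
  loc_unif_cvg H K -> H x t @[x --> +oo] --> K t.
Proof.
move=> t0 /fam_cvgP/(_ [set t]); rewrite uniform_set1; apply; split.
  by move=> _ ->; rewrite /= in_itv/= t0.
exact: compact_set1.
Qed.

Lemma continuous_joint_limit (H : R -> R -> R) (K : R -> R) :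
  (forall t : R, 0 < t -> H p.1 p.2 @[p --> filter_prod +oo_R (nbhs t)] --> K t) ->
  {in `]0, +oo[, continuous K}.
Proof.
move=> HK t; rewrite in_itv/= andbT => t0; apply/cvgrPdist_lt => eps eps0.
have e20 : 0 < eps / 2 by rewrite divr_gt0.
have /cvgrPdist_lt/(_ _ e20) [[A U] /= [Aoo Ut] AU] := HK t t0.
near=> s.
have s0 : 0 < s by near: s; exact: lt_nbhsr.
have /cvgrPdist_lt/(_ _ e20) [[A' U'] /= [Aoo' Us] AU'] := HK s s0.
(* Here [x] is taken after [s], large enough for the limits at both [t] and [s]; the common value
   [H x s] then compares [K t] with [K s]. *)
near (pinfty_nbhs R) => x.
have Htx : `|K t - H x s| < eps / 2.
  by apply: (AU (x, s)); split => /=; [near: x|near: s].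
have Hsx : `|K s - H x s| < eps / 2.
  by apply: (AU' (x, s)); split => /=; [near: x|exact: nbhs_singleton Us].
have -> : K t - K s = (K t - H x s) - (K s - H x s) by ring.
by rewrite [ltRHS]splitr (le_lt_trans (ler_normB _ _))// ltrD.
Unshelve. all: by end_near. Qed.

Lemma loc_unif_cvg_joint (H : R -> R -> R) (K : R -> R) :
  (forall t : R, 0 < t -> H p.1 p.2 @[p --> filter_prod +oo_R (nbhs t)] --> K t) ->
  loc_unif_cvg H K.
Proof.
move=> HK; have K_cont := continuous_joint_limit HK.
apply/fam_cvgP => A [A_pos A_cpt] W; rewrite uniform_nbhs.
rewrite -entourage_ballE => -[E [[eps /= eps0 epsE] EW]].
have e20 : 0 < eps / 2 by rewrite divr_gt0.
suff near_unif : \forall x \near +oo_R, A `<=` [set t | `|K t - H x t| < eps].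
  suff : \forall x \near +oo_R, W (H x) by [].
  near=> x; apply: EW => t At; apply: epsE => /=.
  by have : A `<=` [set t | `|K t - H x t| < eps]; [near: x|exact].
(* Compactness in near-covering form leaves a local claim at each [t] of [A], where [H x s] and, by
   continuity, [K s] are both close to [K t]. *)
move/compact_near_coveringP : A_cpt; apply => t At.
have t0 : t \in `]0, +oo[ by exact: A_pos.
have /cvgrPdist_lt/(_ _ e20) Kt := K_cont t t0.
have t0' : 0 < t by move: t0; rewrite in_itv/= andbT.
have /cvgrPdist_lt/(_ _ e20) [[A' U] /= [A'oo Ut] AU] := HK t t0'.
suff : \forall s \near t & x \near +oo_R, `|K s - H x s| < eps by [].
near=> s x.
have -> : K s - H x s = (K t - H x s) - (K t - K s) by ring.
rewrite [ltRHS]splitr (le_lt_trans (ler_normB _ _))// ltrD//; last by near: s.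
by apply: (AU (x, s)); split => /=; [near: x|near: s].
Unshelve. all: by end_near. Qed.
End regular_variation.

Theorem mainTheorem6 (R : realType) (phi eta f : R -> R) (B : set R)
    (a : rat -> R) (g : R -> R)
    (phi_SE : self_equivarying phi)
    (phi_cont : {in `]0, +oo[, continuous phi})
    (eta_lim : se_limit phi eta)
    (B_pos : B `<=` `]0, +oo[)
    (B_meas : lebesgue_measurable B)
    (B_nonnull : ~ lebesgue_measure.-negligible B)
    (f_pos : positive_fun f)
    (f_meas : lebesgue_measurable_fun f)
    (a_pos : forall q : rat, 0 < q -> 0 < a q)
    (g_pos : forall t, B t -> 0 < g t)
    (g_nontriv : ~ trivial_on B g)
    (kendall : kendall_condition phi f B a g) :
  regularly_varying phi f /\
  exists K : R -> R,
    [/\ forall t, 0 < t -> f (x + t * phi x) / f x @[x --> +oo] --> K t,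
        {in `]0, +oo[, continuous K}
      & forall u v, 0 < u -> 0 < v -> K (popa eta u v) = K v * K u].
Proof.
have [phi_pos phiO _] := phi_SE.
have phi_eta (t : R) (t0 : 0 < t) := loc_unif_cvg_pointwise t0 eta_lim.
have B0 t : B t -> 0 < t by move=> /B_pos /=; rewrite in_itv/= andbT.
have B_unc : ~ countable B.
  move=> B_ctbl; apply: B_nonnull; exists B; split => //.
    by apply: countable_measurable => // t; exact: measurable_set1.
  exact: countable_lebesgue_measure0.
(* Logarithms turn the quotients of [f] into the increments studied above and make the factor [a q]
   additive. *)
pose h := @ln R \o f.
have ln_kendall t : B t -> ln (a p.1) + h (popa phi (ratr p.1) p.2)
    @[p --> filter_prod +oo_rat (nbhs t)] --> ln (g t).
  move=> Bt; set F := filter_prod _ _.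
  have F1 : p.1 @[p --> F] --> +oo_rat by exact: cvg_fst.
  have F2 : p.2 @[p --> F] --> t by exact: cvg_snd.
  have qoo : \forall q \near +oo_rat, 0 < q by exists 0; split => //; exact: real0.
  apply: cvg_trans (cvg_comp _ _ (kendall t Bt) (continuous_ln (g_pos t Bt))).
  apply: near_eq_cvg; near=> p => /=.
  have q0 : 0 < p.1 by near: p; exact: F1 qoo.
  have s0 : 0 < p.2 by near: p; exact: cvgr_gt F2 _ (B0 _ Bt).
  have qR0 : 0 < ratr p.1 :> R by rewrite ltr0q.
  have q_s0 : 0 < popa phi (ratr p.1) p.2.
    by rewrite /popa addr_gt0// mulr_gt0// phi_pos.
  by rewrite lnM// posrE ?a_pos ?f_pos.
have [b bg] := kendall_real (a := fun q => ln (a q)) (g := fun t => ln (g t))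
  phi_pos phi_cont ln_kendall.
(* Only positive [u] carry information: elsewhere [k] is unconstrained. *)
have /choice[k kP] : forall u : R, exists k, 0 < u -> shift_limit phi h u k.
  move=> u; have [u0|_] := ltP 0 u; last by exists 0.
  have [k uk] := shift_limit_gt0 (g := fun t => ln (g t))
    phi_SE phi_cont phi_eta B_pos B_unc bg u0.
  by exists k.
pose K (u : R) := expR (k u).
have joint (t : R) : 0 < t ->
    f (popa phi p.1 p.2) / f p.1 @[p --> filter_prod +oo_R (nbhs t)] --> K t.
  move=> t0; set F := filter_prod _ _.
  have F1 : p.1 @[p --> F] --> +oo by exact: cvg_fst.
  have F2 : p.2 @[p --> F] --> t by exact: cvg_snd.
  apply: cvg_trans (cvg_comp _ _ (kP t t0) (@continuous_expR R (k t))).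
  apply: near_eq_cvg; near=> p => /=.
  have x0 : 0 < p.1 by near: p; exact: cvgry_gt F1 _.
  have s0 : 0 < p.2 by near: p; exact: cvgr_gt F2 _ t0.
  have x_s0 : 0 < popa phi p.1 p.2.
    by rewrite /popa addr_gt0// mulr_gt0// phi_pos.
  by rewrite expRD expRN !lnK// posrE f_pos.
have f_loc_unif := loc_unif_cvg_joint (H := fun x t => f (popa phi x t) / f x) joint.
split; first by split => //; exists K.
exists K; split.
- by move=> t t0; exact: (loc_unif_cvg_pointwise t0 f_loc_unif).
- exact: (continuous_joint_limit (H := fun x t => f (popa phi x t) / f x) joint).
- move=> u v u0 v0.
  have eta_u : 0 < eta u.
    apply: lt_le_trans ltr01 _.
    exact: (se_limit_ge1 phi_pos phi_cont u0 (phi_eta _ u0)).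
  have uv0 : 0 < popa eta u v by rewrite /popa addr_gt0// mulr_gt0.
  have kuv := shift_limitD phi_pos u0 eta_u (phi_eta _ u0) (kP _ u0) (kP _ v0).
  (* The joint limit at [popa eta u v] is both [k (popa eta u v)] and [k u + k v]; uniqueness of
     limits gives the equation. *)
  rewrite /K (cvg_unique (@Rhausdorff R) (kP _ uv0) kuv).
  by rewrite expRD mulrC.
Unshelve. all: by end_near. Qed.
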